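(* Let $G$ be a discrete group, $\mathcal G$ a topological group, and $\rho:G\to\mathcal G$ a homomorphism with dense image. Consider a homomorphism $\rho_0:F_d\to\mathcal G$ from a free group of rank $d$ and a continuous cocycle $B\in\mathrm{C}^n_{\mathrm b}(\mathcal G;\mathbb{R})$. For any $Z\in\mathrm{C}_n(F_d;\mathbb{R})$ and for any $\epsilon>0$, there exists $Z(\epsilon)\in\mathrm{C}_n(G;\mathbb{R})$ such that $$|\rho_0^*B(Z)-\rho^*B(Z(\epsilon))|<\epsilon.$$ Moreover, $\|Z(\epsilon)\|_1\le\|Z\|_1$ and $\|\partial Z(\epsilon)\|_1\le\|\partial Z\|_1$.
   Context: $\mathrm{C}^n_{\mathrm b}(\mathcal G;\mathbb{R})$ is the space of bounded continuous functions $f:\mathcal G^{n+1}\to\mathbb{R}$ invariant under diagonal left multiplication; a cocycle is an element killed by the homogeneous coboundary $\delta f(g_0,\dots,g_{n+1})=\sum_i(-1)^if(g_0,\dots,\hat g_i,\dots,g_{n+1})$. For a discrete group $G$, $\mathrm{C}_n(G;\mathbb{R})$ is the real vector space with basis the $G$-orbits $[g_0,\dots,g_n]$ of $(n+1)$-tuples in $G^{n+1}$ under diagonal left multiplication, with boundary $\partial[g_0,\dots,g_n]=\sum_i(-1)^i[g_0,\dots,\hat g_i,\dots,g_n]$ and $\ell_1$-norm $\|\cdot\|_1$ with respect to this basis. For a homomorphism $\rho:G\to\mathcal G$, $\rho^*B$ is the invariant function $(g_0,\dots,g_n)\mapsto B(\rho(g_0),\dots,\rho(g_n))$, extended linearly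 to a functional on $\mathrm{C}_n(G;\mathbb{R})$. *)

(* Defs.v *)
From HB Require Import structures.
(* freeg first: fintype's [lift] has to shadow freeg's *)
From mathcomp.multinomials Require Import freeg.
From mathcomp Require Import all_boot all_order all_algebra generic_quotient.
From mathcomp Require Import all_classical all_reals topology normedtype.

Set Implicit Arguments.
Unset Strict Implicit.
Unset Printing Implicit Defensive.

Import Order.TTheory GRing.Theory Num.Theory.
Import numFieldNormedType.Exports.

Local Open Scope classical_set_scope.
Local Open Scope ring_scope.
Local Open Scope quotient_scope.

HB.mixin Record isTopologicalGroup T of Topological T & Group T := {
  mulg_continuous : continuous (fun x : T * T => (x.1 * x.2)%g) ;
  invg_continuous : continuous (fun x : T => x^-1%g)
}.

#[short(type="topologicalGroupType")]
HB.structure Definition TopologicalGroup :=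
  {T of Topological T & Group T & isTopologicalGroup T}.

(* The free group on 'I_d, carried by reduced words: the letter (i, false)
    stands for the i-th generator and (i, true) for its inverse. *)

Section FreeGroup.
Variable d : nat.
Local Notation letter := ('I_d * bool)%type.
Implicit Types (x y : letter) (u v w : seq letter).

Definition letter_inv x : letter := (x.1, ~~ x.2).

Definition word_reduced w := sorted (fun x y => y != letter_inv x) w.

Definition word_cons x w : seq letter :=
  if w is y :: w' then if y == letter_inv x then w' else x :: w else [:: x].

Definition word_mul u v : seq letter := foldr word_cons v u.

Definition word_inv w : seq letter := rev (map letter_inv w).

Lemma letter_invK : involutive letter_inv.
Proof. by case=> i b; rewrite /letter_inv /= negbK. Qed.

Lemma word_cons_reduced x w : word_reduced w -> word_reduced (word_cons x w).
Proof.
case: w => [//|y w] /= yw; case: eqP => [_|/eqP ny]; first exact: path_sorted yw.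
by rewrite /= ny.
Qed.

Lemma word_mul_reduced u v : word_reduced v -> word_reduced (word_mul u v).
Proof. by move=> vr; elim: u => //= x u; exact: word_cons_reduced. Qed.

Lemma word_inv_reduced w : word_reduced w -> word_reduced (word_inv w).
Proof.
rewrite /word_reduced /word_inv rev_sorted sorted_map.
apply: sub_sorted => x y /=; rewrite letter_invK => h.
by apply: contra h => /eqP ->.
Qed.

Lemma word_consK x w : word_reduced w ->
  word_cons x (word_cons (letter_inv x) w) = w.
Proof.
case: w => [|y w] /=; first by rewrite eqxx.
rewrite letter_invK; case: eqP => [-> |_ _] /=; last by rewrite eqxx.
by case: w => [//|z w] /= /andP[/negbTE -> _].
Qed.

Lemma word_mul_cons x u v : word_reduced v ->
  word_mul (word_cons x u) v = word_cons x (word_mul u v).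
Proof.
move=> vr; case: u => [//|y u] /=; case: eqP => [->|//].
by rewrite word_consK//; exact: word_mul_reduced.
Qed.

Lemma word_mulA u v w : word_reduced w ->
  word_mul u (word_mul v w) = word_mul (word_mul u v) w.
Proof. by move=> wr; elim: u => //= x u ->; rewrite word_mul_cons. Qed.

Lemma word_mulw0 w : word_reduced w -> word_mul w [::] = w.
Proof.
elim: w => //= x w IHw xw; rewrite IHw; last exact: path_sorted xw.
by case: w xw {IHw} => [//|y w] /= /andP[/negbTE ->].
Qed.

Lemma word_invK : involutive word_inv.
Proof.
by move=> w; rewrite /word_inv map_rev revK (mapK letter_invK).
Qed.

Lemma word_mulVw w : word_mul (word_inv w) w = [::].
Proof.
rewrite /word_inv; elim: w => //= x w IHw.
by rewrite rev_cons /word_mul foldr_rcons /= letter_invK eqxx.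
Qed.

Record free_group := FreeGroup {
  free_word :> seq letter;
  free_word_reduced : word_reduced free_word }.

HB.instance Definition _ := [isSub for free_word].
HB.instance Definition _ := [Choice of free_group by <:].

Definition free_one := @FreeGroup [::] isT.
Definition free_mul (a b : free_group) :=
  FreeGroup (word_mul_reduced a (free_word_reduced b)).
Definition free_inv (a : free_group) :=
  FreeGroup (word_inv_reduced (free_word_reduced a)).

Lemma free_mulA : associative free_mul.
Proof. by move=> a b [w wr]; apply: val_inj; exact: word_mulA. Qed.
Lemma free_mul1 : left_id free_one free_mul.
Proof. by move=> a; exact: val_inj. Qed.
Lemma free_mulr1 : right_id free_one free_mul.
Proof. by move=> [w wr]; apply: val_inj; exact: word_mulw0. Qed.
Lemma free_mulV : left_inverse free_one free_inv free_mul.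
Proof. by move=> a; apply: val_inj; exact: word_mulVw. Qed.
Lemma free_mulrV : right_inverse free_one free_inv free_mul.
Proof.
by move=> a; apply: val_inj; rewrite /= -{1}[free_word a]word_invK word_mulVw.
Qed.

HB.instance Definition _ := isGroup.Build free_group
  free_mulA free_mul1 free_mulr1 free_mulV free_mulrV.

Definition free_gen (i : 'I_d) : free_group := @FreeGroup [:: (i, false)] isT.

Section UniversalProperty.
Local Open Scope group_scope.
Variables (H : groupType) (h : 'I_d -> H).

Definition free_letter x : H := if x.2 then (h x.1)^-1 else h x.1.
Definition free_lift (a : free_group) : H := \prod_(x <- a) free_letter x.

Lemma free_letter_inv x : free_letter (letter_inv x) = (free_letter x)^-1.
Proof. by case: x => i []; rewrite /free_letter /= ?invgK. Qed.

Lemma free_lift_gen i : free_lift (free_gen i) = h i.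
Proof. by rewrite /free_lift big_seq1. Qed.

Lemma free_liftM : {morph free_lift : a b / a * b}.
Proof.
move=> a b; rewrite /free_lift /=.
elim: (free_word a) => [|x u IHu] /=; first by rewrite big_nil mul1g.
rewrite big_cons -mulgA -IHu /word_cons.
case: (word_mul u b) => [|y w]; first by rewrite big_seq1 big_nil mulg1.
case: eqP => [->|_]; last by rewrite [LHS]big_cons.
by rewrite big_cons free_letter_inv mulVKg.
Qed.

Lemma free_lift_unique (phi : {multiplicative free_group -> H}) :
  (forall i, phi (free_gen i) = h i) -> phi =1 free_lift.
Proof.
move=> phih.
have phi1 : phi 1 = 1 by apply: (@mulgI _ (phi 1)); rewrite -gmulfM !mulg1.
have phiV a : phi a^-1 = (phi a)^-1.
  by apply: (@mulgI _ (phi a)); rewrite -gmulfM !mulgV.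
case=> w; elim: w => [|[i b] w IHw] wr.
  by rewrite /free_lift big_nil -phi1; congr (phi _); exact: val_inj.
have wr' : word_reduced w by exact: path_sorted wr.
have -> : FreeGroup wr =
    (if b then (free_gen i)^-1 else free_gen i) * FreeGroup wr'.
  apply: val_inj; case: b wr => /=; case: w wr' {IHw} => [|y w] //= _;
    by case/andP => /negbTE ->.
rewrite gmulfM IHw free_liftM; congr (_ * _).
case: b {wr}; last by rewrite phih free_lift_gen.
by rewrite phiV phih /free_lift big_seq1.
Qed.

End UniversalProperty.

End FreeGroup.

Section Chains.
Variables (R : realType) (G : groupType).

Definition same_orbit m (s t : 'I_m -> G) : bool :=
  `[< exists g : G, t = (fun i => g * s i)%g >].

Lemma same_orbit_refl m : reflexive (@same_orbit m).
Proof.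
by move=> t; apply/asboolP; exists 1%g; apply/funext => i; rewrite mul1g.
Qed.

Lemma same_orbit_sym m : symmetric (@same_orbit m).
Proof.
move=> s t; apply/asboolP/asboolP => -[g ->]; exists (g^-1)%g;
  by apply/funext => i; rewrite mulKg.
Qed.

Lemma same_orbit_trans m : transitive (@same_orbit m).
Proof.
move=> t s u /asboolP[g ->] /asboolP[h ->]; apply/asboolP; exists (h * g)%g.
by apply/funext => i; rewrite mulgA.
Qed.

Canonical same_orbit_equiv m := EquivRel (@same_orbit m)
  (@same_orbit_refl m) (@same_orbit_sym m) (@same_orbit_trans m).

Definition orbits m := {eq_quot @same_orbit m}.

HB.instance Definition _ m := Choice.on (orbits m).
HB.instance Definition _ m := EqQuotient.on (orbits m).

Definition orbit_of m (t : 'I_m -> G) : orbits m := \pi_(orbits m) t.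

Definition chain n := {freeg (orbits n.+1) / R}.

Definition l1norm n (Z : chain n) : R := \sum_(o <- dom Z) `|coeff o Z|.

(* Index n.-1 with value 0 at n = 0: the complex is not augmented. *)
Definition boundary n : chain n -> chain n.-1 :=
  match n return chain n -> chain n.-1 with
  | 0%N => fun=> 0
  | n'.+1 => fglift (fun o : orbits n'.+2 =>
      \sum_(i < n'.+2)
         << (-1) ^+ i *g orbit_of (repr o \o lift i) >> : chain n')
  end.

(* The linear extension of a function on tuples; it depends only on f when f is
   left-invariant, see [chain_evalE]. *)
Definition chain_eval n (f : ('I_n.+1 -> G) -> R) (Z : chain n) : R :=
  fglift (fun o : orbits n.+1 => f (repr o) : R^o) Z.

End Chains.

Definition left_invariant (R : realType) (G : groupType) n
    (f : ('I_n.+1 -> G) -> R) :=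
  forall (g : G) (t : 'I_n.+1 -> G), f (fun i => g * t i)%g = f t.

Definition coboundary (R : realType) (G : groupType) n
    (f : ('I_n.+1 -> G) -> R) (t : 'I_n.+2 -> G) : R :=
  \sum_(i < n.+2) (-1) ^+ i * f (t \o lift i).

Definition cocycle (R : realType) (G : groupType) n
    (f : ('I_n.+1 -> G) -> R) :=
  forall t, coboundary f t = 0.

Definition pullback (R : realType) (G H : groupType) n (rho : G -> H)
    (f : ('I_n.+1 -> H) -> R) (t : 'I_n.+1 -> G) : R := f (rho \o t).

Definition Cb (R : realType) (T : topologicalGroupType) n :
    set (('I_n.+1 -> T) -> R) :=
  [set f | [/\ continuous (f : {ptws 'I_n.+1 -> T} -> R),
               exists M : R, forall t, `|f t| <= M
             & left_invariant f]].

Arguments Cb : clear implicits.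

Section WellDefined.
Variables (R : realType) (G : groupType).

Lemma repr_orbit_of m (t : 'I_m -> G) :
  exists g : G, repr (orbit_of t) = (fun i => g * t i)%g.
Proof.
suff /asboolP : same_orbit t (repr (orbit_of t)) by [].
have := reprK (orbit_of t).
by move/eqP; rewrite /orbit_of eqmodE /= same_orbit_sym.
Qed.

Lemma chain_evalE n (f : ('I_n.+1 -> G) -> R) (t : 'I_n.+1 -> G) :
  left_invariant f -> chain_eval f (<< orbit_of t >> : chain R G n) = f t.
Proof.
move=> finv; rewrite /chain_eval liftU scale1r.
by have [g ->] := repr_orbit_of t.
Qed.

Lemma boundaryE n (t : 'I_n.+2 -> G) :
  boundary (<< orbit_of t >> : chain R G n.+1) =
  \sum_(i < n.+2) << (-1) ^+ i *g orbit_of (t \o lift i) >>.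
Proof.
rewrite /boundary liftU scale1r; apply: eq_bigr => i _.
congr << _ *g _ >>; have [g ->] := repr_orbit_of t.
apply/eqP; rewrite /orbit_of eqmodE /= same_orbit_sym.
by apply/asboolP; exists g; apply/funext.
Qed.

Lemma pullback_invariant (H : groupType) n (rho : {multiplicative G -> H})
    (f : ('I_n.+1 -> H) -> R) :
  left_invariant f -> left_invariant (pullback rho f).
Proof.
move=> finv g t; rewrite /pullback -[RHS](finv (rho g)); congr f.
by apply/funext => i /=; rewrite gmulfM.
Qed.

End WellDefined.

(* Main.v *)
Require Import Defs.
From HB Require Import structures.
From mathcomp.multinomials Require Import freeg.
From mathcomp Require Import all_boot all_order all_algebra.
From mathcomp Require Import all_classical all_reals topology normedtype.

(** The chain Z(eps) is a push-forward of Z. A homomorphism out of a free group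
    may be prescribed freely on generators, so for any h_1, ..., h_d in G there
    is a homomorphism phi : F_d -> G with phi(x_i) = h_i, and it induces a chain
    map phi_* between the complexes of orbits ([chain_map]). A chain map that
    sends basis elements to basis elements cannot increase the l1-norm, neither
    of Z ([l1norm_map]) nor of its boundary ([boundary_map]); both norm
    estimates hold whatever the h_i are.

    It remains to choose the h_i so that the evaluations are close. Evaluating
    rho^*B on phi_* Z amounts to evaluating (rho o phi)^*B on Z
    ([chain_eval_map]), and rho o phi is the homomorphism that sends x_i to
    rho(h_i). A homomorphism F_d -> T depends continuously on the images of the
    generators, in that its value at each word is a finite product of these
    images and their inverses; since B is continuous and Z has finite support,
    the value on Z of the function pulled back from B is a continuous function
    of a point of T^d ([chain_eval_free_lift_continuous]). Finally rho(G)^d is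
    dense in T^d ([dense_family]), so some point (rho(h_1), ..., rho(h_d)) gives
    a value within eps of the one at (rho0(x_1), ..., rho0(x_d)), which is the
    evaluation of rho0^*B on Z. *)

Set Implicit Arguments.
Unset Strict Implicit.
Unset Printing Implicit Defensive.

Import Order.TTheory GRing.Theory Num.Theory.
Import numFieldNormedType.Exports.

Local Open Scope classical_set_scope.
Local Open Scope ring_scope.

Section LinearExtension.
Variables (R : nzRingType) (K : choiceType) (M : lmodType R).
Implicit Types (f : K -> M) (D : {freeg K / R}).

HB.instance Definition _ f :=
  GRing.isZmodMorphism.Build {freeg K / R} M (fglift f) (lift_is_additive f).

Lemma fgliftE f D : fglift f D = \sum_(x <- dom D) coeff x D *: f x.
Proof.
rewrite -[in LHS](freeg_sumE D) raddf_sum.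
by apply: eq_bigr => x _; exact: liftU.
Qed.

Lemma fglift_scalable f : scalable (fglift f).
Proof.
move=> c D; rewrite [c *: D]/(fgscale c D) raddf_sum fgliftE scaler_sumr.
by apply: eq_bigr => x _; rewrite scalerA; exact: liftU.
Qed.

HB.instance Definition _ f :=
  GRing.isScalable.Build R {freeg K / R} M *:%R (fglift f) (fglift_scalable f).

Lemma freegUZ (k : R) (x : K) : << k *g x >> = k *: << x >>.
Proof. by apply/eqP/freeg_eqP => y; rewrite coeffZ !coeffU mul1r. Qed.

Lemma linear_fglift (u : {linear {freeg K / R} -> M}) D :
  u D = fglift (fun x => u << x >>) D.
Proof.
rewrite fgliftE -[in LHS](freeg_sumE D) linear_sum; apply: eq_bigr => x _.
by rewrite freegUZ linearZ.
Qed.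

Lemma linear_freeg_ext (u v : {linear {freeg K / R} -> M}) :
  (forall x, u << x >> = v << x >>) -> u =1 v.
Proof.
move=> uv D; rewrite (linear_fglift u) (linear_fglift v).
by congr fglift; exact/funext.
Qed.

End LinearExtension.

Section ChainMap.
Variables (R : realType) (G H : groupType) (phi : {multiplicative G -> H}).

Definition chain_map n : chain R G n -> chain R H n :=
  fglift (fun o : orbits G n.+1 => << orbit_of (phi \o repr o) >>).

HB.instance Definition _ n := GRing.Linear.on (@chain_map n).

Lemma chain_mapE n (k : R) (t : 'I_n.+1 -> G) :
  chain_map << k *g orbit_of t >> = << k *g orbit_of (phi \o t) >>.
Proof.
rewrite /chain_map liftU -freegUZ; congr << _ *g _ >>.
have [g ->] := repr_orbit_of t; apply/eqP.
rewrite /orbit_of eqmodE /= same_orbit_sym; apply/asboolP; exists (phi g).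
by apply/funext => i /=; rewrite gmulfM.
Qed.

(** Every orbit is the orbit of a tuple, so identities between linear maps on
    chains can be tested on tuples, without reference to chosen representatives:
    there [chain_evalE], [boundaryE] and [chain_mapE] apply. *)
Lemma chain_linear_ext n (M : lmodType R) (u v : {linear chain R G n -> M}) :
  (forall t, u << orbit_of t >> = v << orbit_of t >>) -> u =1 v.
Proof.
move=> uv; apply: linear_freeg_ext => o.
by rewrite -[o]reprK; exact: uv.
Qed.

Lemma chain_eval_map n (f : ('I_n.+1 -> H) -> R) (Z : chain R G n) :
  left_invariant f -> chain_eval f (chain_map Z) = chain_eval (pullback phi f) Z.
Proof.
move=> finv.
apply: (@chain_linear_ext n R^o
  (fglift (fun o : orbits H n.+1 => f (repr o) : R^o) \o @chain_map n)
  (fglift (fun o : orbits G n.+1 => pullback phi f (repr o) : R^o))) => t /=.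
rewrite chain_mapE; apply: etrans (chain_evalE _ finv) _.
exact: esym (chain_evalE t (pullback_invariant phi finv)).
Qed.

(** Applying [phi] to each entry of a tuple commutes with omitting an entry. In
    degree 0 both sides vanish, the complex being not augmented. *)
Lemma boundary_map n (Z : chain R G n) :
  boundary (chain_map Z) = chain_map (boundary Z).
Proof.
case: n Z => [|n] Z; first by rewrite /= raddf0.
apply: (@chain_linear_ext n.+1 _
  (fglift _ \o @chain_map n.+1) (@chain_map n \o fglift _)) Z => t /=.
rewrite chain_mapE.
apply: etrans (boundaryE _ _) _.
apply: etrans (congr1 (@chain_map n) (esym (boundaryE _ _))).
by rewrite linear_sum; apply: eq_bigr => i _; rewrite [RHS]chain_mapE.
Qed.

(** The norm of a chain is attained by pairing it with the signs of its
    coefficients, so it becomes the value of a linear functional. *)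
Lemma l1norm_sg (K : groupType) n (Z : chain R K n) :
  l1norm Z = fglift (fun o => Num.sg (coeff o Z) : R^o) Z.
Proof.
by rewrite fgliftE; apply: eq_bigr => o _; rewrite normrEsg mulrC.
Qed.

(** Distinct orbits may have the same image, and their coefficients may cancel.
    This needs no bookkeeping if one pairs the image with the signs of its
    coefficients: pulled back to the source, this is a pairing of [Z] with
    numbers of absolute value at most 1. *)
Lemma l1norm_map n (Z : chain R G n) : l1norm (chain_map Z) <= l1norm Z.
Proof.
rewrite l1norm_sg; set s := fun o => _.
rewrite [chain_map Z]fgliftE linear_sum; apply: ler_sum => o _.
rewrite linearZ /= liftU scale1r.
apply: le_trans (ler_norm _) _; rewrite normrM normr_sg.
by rewrite ler_piMr// lern1 leq_b1.
Qed.

End ChainMap.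

(** A point of an open set is moved into the product of the dense sets one
    coordinate at a time: changing a single coordinate is a continuous map into
    the product, so the values of that coordinate that stay in the open set form
    a nonempty open set. Finiteness of the index set makes this terminate. *)
Lemma dense_family (I : finType) (K : I -> topologicalType)
    (D : forall i, set (K i)) :
  (forall i, dense (D i)) ->
  dense [set x : prod_topology K | forall i, D i (x i)].
Proof.
move=> Dd A [x Ax] oA.
suff [y [Ay Dy]] : exists y, A y /\ forall i, i \in enum I -> D i (y i).
  by exists y; split=> // i; apply: Dy; rewrite mem_enum.
elim: (enum I) => [|i r [y [Ay Dy]]]; first by exists x.
have [z [Az Dz]] : (@dfwith I K y i @^-1` A) `&` D i !=set0.
  apply: Dd.
    exists (y i); rewrite /preimage /=.
    suff -> : @dfwith I K y i (y i) = y by [].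
    by apply: functional_extensionality_dep => j; case: dfwithP.
  by apply: open_comp oA => z _; exact: dfwith_continuous.
exists (@dfwith I K y i z); split=> // j.
by case: dfwithP => // k ik; rewrite inE eq_sym (negbTE ik) /= => /Dy.
Qed.

Lemma continuous_prod_topology (X : topologicalType) (I : Type)
    (K : I -> topologicalType) (f : X -> prod_topology K) :
  (forall i, continuous (fun x => f x i)) -> continuous f.
Proof.
move=> fc x; apply/cvg_sup => i.
exact: (continuous_comp_initial (w := fun y : prod_topology K => y i) (fc i)).
Qed.

Section FreeLift.
Variables (T : topologicalGroupType) (d : nat).

(** Written out along the word [a], the value is a finite product of coordinates
    of [x] and their inverses. *)
Lemma free_lift_continuous (a : free_group d) :
  continuous (fun x : {ptws 'I_d -> T} => free_lift x a).
Proof.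
rewrite /free_lift.
apply: (@continuous_big T _ _ 1%g xpredT (@mulg_continuous T) {ptws 'I_d -> T} _
  (fun l x => free_letter x l)) => -[i b] _ x.
have xi : {for x, continuous (fun y : {ptws 'I_d -> T} => y i)}.
  exact: (@proj_continuous _ (fun=> T) i).
rewrite /free_letter; case: b => //=.
by apply: (continuous_comp xi); exact: invg_continuous.
Qed.

(** The evaluation is a finite sum, one term for each orbit in the support of
    [Z], and each term sees [x] only through the images of the finitely many
    words in a representative of the orbit. *)
Lemma chain_eval_free_lift_continuous (R : realType) n
    (B : ('I_n.+1 -> T) -> R) (Z : chain R (free_group d) n) :
  continuous (B : {ptws 'I_n.+1 -> T} -> R) ->
  continuous (fun x : {ptws 'I_d -> T} => chain_eval (pullback (free_lift x) B) Z).
Proof.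
move=> Bc.
have -> : (fun x : {ptws 'I_d -> T} => chain_eval (pullback (free_lift x) B) Z) =
    fun x => \sum_(o <- dom Z) coeff o Z * B (free_lift x \o repr o).
  by apply/funext => x; exact: fgliftE.
have addc : continuous (fun z : R * R => z.1 + z.2).
  by move=> z; apply: cvgD; [exact: cvg_fst|exact: cvg_snd].
apply: (@continuous_big R _ _ 0 xpredT addc {ptws 'I_d -> T} _
  (fun o x => coeff o Z * B (free_lift x \o repr o))) => o _ x.
have fc : continuous
    (fun y : {ptws 'I_d -> T} => (free_lift y \o repr o : {ptws 'I_n.+1 -> T})).
  by apply: continuous_prod_topology => i; exact: free_lift_continuous.
exact: (cvgM (cvg_cst _) (continuous_comp (fc x) (Bc _))).
Qed.

End FreeLift.

Section FreeLiftMorphism.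
Variables (d : nat) (H : groupType) (h : 'I_d -> H).
HB.instance Definition _ :=
  isMultiplicative.Build (free_group d) H (free_lift h) (free_liftM h).
End FreeLiftMorphism.

Theorem proposition2p8 (R : realType) (G : groupType)
    (T : topologicalGroupType) (rho : {multiplicative G -> T})
    (d : nat) (rho0 : {multiplicative free_group d -> T})
    (n : nat) (B : ('I_n.+1 -> T) -> R) :
  dense (range rho) ->
  Cb R T n B -> cocycle B ->
  forall (Z : chain R (free_group d) n) (eps : R), 0 < eps ->
  exists Zeps : chain R G n,
    [/\ `|chain_eval (pullback rho0 B) Z - chain_eval (pullback rho B) Zeps| < eps,
        l1norm Zeps <= l1norm Z
      & l1norm (boundary Zeps) <= l1norm (boundary Z)].
Proof.
move=> rhod [Bc _ Binv] _ Z eps eps0.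
pose ev (x : {ptws 'I_d -> T}) := chain_eval (pullback (free_lift x) B) Z.
pose x0 : {ptws 'I_d -> T} := rho0 \o @free_gen d.
have oA : open (ev @^-1` ball (ev x0) eps).
  apply: open_comp; last exact: ball_open.
  by move=> x _; exact: chain_eval_free_lift_continuous.
have [|x [evx rhox]] := dense_family (fun=> rhod) _ oA.
  by exists x0; exact: ballxx.
(* Density gives preimages of the coordinates separately; a choice of them is
   the tuple of images of the generators. *)
have [h hx] : exists h : 'I_d -> G, rho \o h = x.
  exists (fun i => projT1 (cid2 (rhox i))); apply/funext => i /=.
  by case: cid2.
(* By uniqueness of extensions from the generators, rho0 is the homomorphism
   that corresponds to the point x0. *)
have -> : rho0 = free_lift x0 :> (_ -> _) by apply/funext/free_lift_unique.
exists (chain_map (free_lift h) Z); split.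
- rewrite chain_eval_map; last exact: pullback_invariant.
  have rhoh : rho \o free_lift h = free_lift x.
    apply/funext/free_lift_unique => i.
    by rewrite -hx /= free_lift_gen.
  by rewrite -[pullback (free_lift h) _]/(pullback (rho \o free_lift h) B) rhoh.
- exact: l1norm_map.
- by rewrite boundary_map; exact: l1norm_map.
Qed.
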